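(* Let $X$ be a uniformly smooth Banach space and let $1<s<\infty$. Then the following statements are equivalent (where $C>0$ denotes generic constants, possibly different in each statement, which do not depend on $x,y$): 1. $X$ is $s$-smooth. 2. For some $p$ with $1<p<\infty$, the duality mapping $J_p^X$ is single-valued and there is $C>0$ such that for all $x,y\in X$ $$\|j_p^X(x)-j_p^X(y)\|_{X^*}\le C\max(\|x\|_X,\|y\|_X)^{p-s}\,\|x-y\|_X^{s-1}.$$ 3. The statement in 2 holds for all $p$ with $1<p<\infty$. 4. For some $p$ with $1<p<\infty$ we have, for all $x,y\in X$, $$\|x-y\|^p\le\|x\|^p-p\langle j_p^X(x),y\rangle+\tilde\sigma_p(x,y),$$ and furthermore there is $C>0$ such that for all $x,y\in X$ $$\tilde\sigma_p(x,y)\le C\,p\int_0^1 h^{s-1}\max(\|x-hy\|,\|x\|)^{p-s}\,\|y\|^s\,dh .$$ 5. The statement in 4 holds for all $p$ with $1<p<\infty$.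
   Context: For $q\ge1$ the duality mapping is $J_q^X(x)=\{x^*\in X^*:\langle x,x^*\rangle=\|x\|\,\|x^*\|,\ \|x^*\|=\|x\|^{q-1}\}$, and $j_q^X$ denotes a single-valued selection (in a uniformly smooth space every $J_q^X$, $q>1$, is single-valued). The modulus of smoothness is $\rho_X(\varepsilon)=\frac12\sup\{\|x+y\|+\|x-y\|-2:\|x\|=1,\ \|y\|\le\varepsilon\}$, $\varepsilon\ge 0$. $X$ is uniformly smooth if $\lim_{\varepsilon\to0}\rho_X(\varepsilon)/\varepsilon=0$. $X$ is $s$-smooth (smooth of power-type $s$) if there is a constant $G_s^X>0$ such that for all $x,y\in X$: $\|x-y\|^s\le\|x\|^s-s\langle j_s^X(x),y\rangle+G_s^X\|y\|^s$. For $1<p<\infty$, $$\tilde\sigma_p(x,y)=p\,G_p'\int_0^1\frac{\max(\|x-hy\|,\|x\|)^p}{h}\,\rho_X\!\left(\frac{h\|y\|}{\max(\|x-hy\|,\|x\|)}\right)dh ,$$ where $G_p'>0$ is the constant of the Xu–Roach inequalities (Xu and Roach, 1991): for a uniformly smooth Banach space $X$ these state that for all $x,y\in X$, $\|j_p^X(x)-j_p^X(y)\|_{X^*}\le G_p'\max(\|x\|,\|y\|)^p\|x-y\|^{-1}\rho_X\big(\|x-y\|/\max(\|x\|,\|y\|)\big)$ and $\|x-y\|^p\le\|x\|^p-p\langle j_p^X(x),y\rangle+\tilde\sigma_p(x,y)$. Expressions in which $\max(\cdot,\cdot)=0$ (i.e. $x=y=0$) are interpreted as $0$.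
   Formalization: The Xu–Roach inequalities with constant G'_p are assumed for the given X for every p>1; this excludes one-dimensional X, where (e.g. X=ℝ, s=2) no such G'_p exists, since ρ_X=0 on [0,1], and 1⇒4 fails. *)

(* Defs.v *)
From HB Require Import structures.
From mathcomp Require Import all_boot all_order all_algebra.
From mathcomp Require Import all_classical all_reals all_analysis.

Set Implicit Arguments.
Unset Strict Implicit.
Unset Printing Implicit Defensive.

Import Order.TTheory GRing.Theory Num.Theory.
Import numFieldNormedType.Exports.

Local Open Scope classical_set_scope.
Local Open Scope ring_scope.

(* Degenerate values.  In MathComp `0^-1 = 0`, and ``0 `^ r = 0`` for `r != 0`.
   Hence for x = y = 0 the expressions below that involve
   max(|x|, |y|) or max(|x - h y|, |x|) all evaluate to 0 (each of them has a
   factor |y|, |x - y| or max^p raised to a nonzero power), and so does the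
   right-hand side of the first Xu-Roach inequality when x = y. *)

Section duality.
Context {R : realType} {X : normedModType R}.
Implicit Types (x y : X) (f : X -> R) (p q s e : R).

Definition dual : set (X -> R) := [set f : X -> R | scalar f /\ continuous f].

Definition dual_norm f : R := sup [set `|f x| | x in [set x : X | `|x| <= 1]].

Definition duality_mapping q x : set (X -> R) :=
  [set f | [/\ dual f, f x = `|x| * dual_norm f
             & dual_norm f = `|x| `^ (q - 1)]].

Definition single_valued (J : X -> set (X -> R)) : Prop :=
  forall x, exists! f, J x f.

Definition selection (J : X -> set (X -> R)) (j : X -> X -> R) : Prop :=
  forall x, J x (j x).

End duality.

Section smoothness.
Context {R : realType} (X : normedModType R).
Implicit Types (x y : X) (p s e G : R).

(* For X = {0} the set is empty and the modulus is 0. *)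
Definition smoothness_modulus e : R :=
  2^-1 * sup [set r | exists x y : X,
    [/\ `|x| = 1, `|y| <= e & r = `|x + y| + `|x - y| - 2]].

(* The modulus only makes sense for e >= 0, hence the right-sided limit. *)
Definition uniformly_smooth : Prop :=
  smoothness_modulus e / e @[e --> 0^'+] --> (0 : R).

End smoothness.

Section characterizations.
Context {R : realType} {X : normedModType R}.
Implicit Types (x y : X) (p s G : R).
(* j q is a selection of the duality mapping of weight q;
   the pairing <j_q(x), y> is j q x y *)
Implicit Type j : R -> X -> X -> R.

Definition power_smooth j s : Prop :=
  exists2 G, 0 < G & forall x y,
    `|x - y| `^ s <= `|x| `^ s - s * j s x y + G * `|y| `^ s.

(* The integrand is nonnegative, and bounded since the modulus at t is at
   most t, so that the real-valued Lebesgue integral is meaningful. *)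
Definition sigma_tilde G p x y : R :=
  p * G * \int[lebesgue_measure]_(h in `[0, 1])
    (Num.max `|x - h *: y| `|x| `^ p / h *
     smoothness_modulus X (h * `|y| / Num.max `|x - h *: y| `|x|)).

Definition smooth_inequality j G p : Prop := forall x y,
  `|x - y| `^ p <= `|x| `^ p - p * j p x y + sigma_tilde G p x y.

(* G is an admissible constant in the Xu-Roach inequalities for X with
   exponent p.  The constant is relative to X: no constant is admissible for
   X = R, whose modulus of smoothness vanishes on [0, 1]. *)
Definition xu_roach_constant j G p : Prop :=
  [/\ 0 < G,
      forall x y, dual_norm (j p x \- j p y) <=
        G * Num.max `|x| `|y| `^ p * `|x - y|^-1 *
        smoothness_modulus X (`|x - y| / Num.max `|x| `|y|)
    & smooth_inequality j G p].

Definition duality_mapping_holder j s p : Prop :=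
  single_valued (@duality_mapping R X p) /\
  exists2 C : R, 0 < C & forall x y,
    dual_norm (j p x \- j p y) <=
      C * Num.max `|x| `|y| `^ (p - s) * `|x - y| `^ (s - 1).

(* The integral on the right-hand side is finite: if p < s and x != 0 the
   maximum is at least |x| > 0, and if x = 0 the integrand is
   h^(p-1) |y|^p. *)
Definition sigma_tilde_bound j G s p : Prop :=
  smooth_inequality j G p /\
  exists2 C : R, 0 < C & forall x y,
    sigma_tilde G p x y <=
      C * p * \int[lebesgue_measure]_(h in `[0, 1])
        (h `^ (s - 1) * Num.max `|x - h *: y| `|x| `^ (p - s) * `|y| `^ s).

End characterizations.

(* Main.v *)
(* All five statements are equivalent to a power-type bound on the modulus,
   rho_X(e) <= C e^s.  Given this bound, the first Xu-Roach inequality yields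
   the Hoelder estimate of J_p for every p, and inserting it pointwise under the
   integral yields the bound on sigma_p for every p; for p = s the latter is
   s-smoothness.
   Conversely, each of the statements gives, for some p > 1,
   |x + y|^p + |x - y|^p <= 2 + C |y|^s when |x| = 1 and |y| <= 1: add the
   inequalities for y and -y or, in the Hoelder case, the subgradient
   inequalities of |.|^p at x + y and x - y.  Bernoulli's inequality
   p (a - 1) <= a^p - 1 then bounds |x + y| + |x - y| - 2, and for e > 1 the
   trivial bound rho_X(e) <= e <= e^s suffices. *)
Require Import Defs.
From HB Require Import structures.
From mathcomp Require Import all_boot all_order all_algebra.
From mathcomp Require Import all_classical all_reals all_analysis.
From mathcomp Require Import measurable_realfun ring lra.

Set Implicit Arguments.
Unset Strict Implicit.
Unset Printing Implicit Defensive.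

Import Order.TTheory GRing.Theory Num.Theory.
Import numFieldNormedType.Exports.

Local Open Scope classical_set_scope.
Local Open Scope ring_scope.

(** * Inequalities for real powers *)

Lemma powR_le1 (R : realType) (a r : R) : 0 <= r -> 0 <= a <= 1 -> a `^ r <= 1.
Proof.
move=> r0 /andP[a0 a1]; apply: (@le_trans _ _ (1 `^ r)); last by rewrite powR1.
by rewrite ge0_ler_powR ?nnegrE.
Qed.

(** Young's inequality for [a] and 1 with the conjugate exponents [p] and [p / (p - 1)]. *)
Lemma powR_bernoulli (R : realType) (p a : R) :
  1 < p -> 0 <= a -> p * (a - 1) <= a `^ p - 1.
Proof.
move=> p1 a0; have p0 : 0 < p by lra.
have q0 : 0 < p / (p - 1) by rewrite divr_gt0 ?subr_gt0.
have /(_ _)/= := conjugate_powR a0 ler01 p0 q0.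
rewrite powR1 mulr1 mul1r invf_div => /(_ _)/= H.
have {H}: a <= a `^ p / p + (p - 1) / p by apply: H; field; lra.
rewrite -mulrDl ler_pdivlMr//; lra.
Qed.

(** Young's inequality for [a] and [b ^ (p - 1)] with the same exponents. *)
Lemma powR_young (R : realType) (p a b : R) :
  1 < p -> 0 <= a -> 0 <= b ->
  p * (a * b `^ (p - 1)) <= a `^ p + (p - 1) * b `^ p.
Proof.
move=> p1 a0 b0; have p0 : 0 < p by lra.
have q0 : 0 < p / (p - 1) by rewrite divr_gt0 ?subr_gt0.
have := conjugate_powR a0 (powR_ge0 b (p - 1)) p0 q0.
rewrite -powRrM (_ : (p - 1) * (p / (p - 1)) = p); last by field; lra.
rewrite invf_div => H.
have {H}: a * b `^ (p - 1) <= a `^ p / p + b `^ p * ((p - 1) / p).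
  by apply: H; field; lra.
rewrite mulrA -mulrDl ler_pdivlMr//; lra.
Qed.

(* Unlike [ge0_le_integral], no measurability is required: the integral of a
   nonnegative function is a supremum over the simple functions below it.
   This spares the measurability of the modulus of smoothness. *)
Lemma ge0_le_integral_nonmeasurable d (T : measurableType d) (R : realType)
    (mu : {measure set T -> \bar R}) (D : set T) (f g : T -> \bar R) :
  (forall x, D x -> 0 <= f x)%E -> (forall x, D x -> f x <= g x)%E ->
  (\int[mu]_(x in D) f x <= \int[mu]_(x in D) g x)%E.
Proof.
move=> f0 fg.
have g0 x : D x -> (0 <= g x)%E by move=> Dx; rewrite (le_trans (f0 x Dx)) ?fg.
rewrite !ge0_integralE//; apply: ereal_sup_le => _ /= [h hf <-].
exists h => // x; rewrite (le_trans (hf x))//.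
exact: lee_restrict.
Qed.

(** * Bounds for integrals over the unit interval *)

Section itv01.
Context {R : realType}.
Notation mu := (@lebesgue_measure R).
Implicit Types (f g : R -> R) (K : R).

Lemma integral01_le f K : (forall h, 0 <= h <= 1 -> 0 <= f h <= K) ->
  ((\int[mu]_(h in `[0%R, 1%R]) (f h)%:E) <= K%:E)%E.
Proof.
move=> fK.
have -> : (K%:E = \int[mu]_(h in `[0%R, 1%R]) (cst K%:E h))%E.
  rewrite integral_cst//= lebesgue_measure_itv/= lte_fin ltr01 oppr0 adde0.
  by rewrite mule1.
by apply: ge0_le_integral_nonmeasurable => h /=;
  rewrite in_itv/= => /fK/andP[? ?]; rewrite lee_fin.
Qed.

Lemma fin_num_integral01 f K : (forall h, 0 <= h <= 1 -> 0 <= f h <= K) ->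
  (\int[mu]_(h in `[0%R, 1%R]) (f h)%:E)%E \is a fin_num.
Proof.
move=> fK; rewrite ge0_fin_numE.
  exact: le_lt_trans (integral01_le fK) (ltry _).
by apply: integral_ge0 => h /=; rewrite in_itv/= => /fK/andP[? ?]; rewrite lee_fin.
Qed.

Lemma Rintegral01_le_bound f K : (forall h, 0 <= h <= 1 -> 0 <= f h <= K) ->
  \int[mu]_(h in `[0%R, 1%R]) f h <= K.
Proof.
by move=> fK; rewrite -lee_fin fineK ?integral01_le ?(fin_num_integral01 fK).
Qed.

(** The bound [K] keeps both integrals finite: the real-valued integral reads an infinite one as 0,
    which would break monotonicity. *)
Lemma le_Rintegral01 f g K : (forall h, 0 <= h <= 1 -> 0 <= f h <= g h) ->
  (forall h, 0 <= h <= 1 -> g h <= K) ->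
  \int[mu]_(h in `[0%R, 1%R]) f h <= \int[mu]_(h in `[0%R, 1%R]) g h.
Proof.
move=> fg gK.
have fK h : 0 <= h <= 1 -> 0 <= f h <= K.
  by move=> h01; have /andP[-> /le_trans->//] := fg _ h01; exact: gK.
have gK' h : 0 <= h <= 1 -> 0 <= g h <= K.
  by move=> h01; have /andP[/le_trans ff /ff->//] := fg _ h01; exact: gK.
rewrite fine_le ?(fin_num_integral01 fK) ?(fin_num_integral01 gK')//.
by apply: ge0_le_integral_nonmeasurable => h /=;
  rewrite in_itv/= => /fg/andP[? ?]; rewrite lee_fin.
Qed.

End itv01.

(** * Bounded functionals and the duality mapping *)

Section dual_space.
Context {R : realType} {X : normedModType R}.
Implicit Types (f g : X -> R) (x y z w : X) (p : R).

Lemma dualD f x y : dual f -> f (x + y) = f x + f y.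
Proof. by move=> [lf _]; have := lf 1 x y; rewrite scale1r mul1r. Qed.

Lemma dual0 f : dual f -> f 0 = 0.
Proof. by move=> df; have := dualD 0 0 df; rewrite addr0; lra. Qed.

Lemma dualZ f (a : R) x : dual f -> f (a *: x) = a * f x.
Proof.
by move=> df; have [lf _] := df; have := lf a x 0; rewrite (dual0 df) !addr0.
Qed.

Lemma dualN f x : dual f -> f (- x) = - f x.
Proof. by move=> df; rewrite -scaleN1r (dualZ _ _ df) mulN1r. Qed.

Lemma dualB f x y : dual f -> f (x - y) = f x - f y.
Proof. by move=> df; rewrite (dualD _ _ df) (dualN _ df). Qed.

Lemma dual_sub f g : dual f -> dual g -> dual (f \- g).
Proof.
move=> df dg; split.
  move=> a u v /=; rewrite !(dualD _ _ df) !(dualD _ _ dg).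
  by rewrite (dualZ _ _ df) (dualZ _ _ dg); ring.
by move=> x; apply: cvgB; [exact: df.2|exact: dg.2].
Qed.

(** Continuity at 0 bounds [f] on the unit ball. Hence the [sup] in [dual_norm] is a true supremum,
    not the default 0 of an unbounded set. *)
Lemma dual_has_ubound f : dual f ->
  has_ubound [set `|f x| | x in [set x : X | `|x| <= 1]].
Proof.
move=> [lf cf].
pose F : {linear X -> R^o} :=
  HB.pack f (GRing.isLinear.Build R X R^o *:%R f lf).
have /linear_boundedP : bounded_near F (nbhs (0 : X)).
  by apply: continuous_linear_bounded; exact: cf.
move=> /pinfty_ex_gt0[r r0 fr]; exists r => _ [x /= x1 <-].
by rewrite (le_trans (fr x))// ger_pMr.
Qed.

Lemma ler_dual_norm f x : dual f -> `|f x| <= dual_norm f * `|x|.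
Proof.
move=> df; have [->|x0] := eqVneq x 0; first by rewrite (dual0 df) !normr0 mulr0.
have nx0 : 0 < `|x| by rewrite normr_gt0.
rewrite -ler_pdivrMr//.
apply: (ub_le_sup (dual_has_ubound df)); exists (`|x|^-1 *: x) => /=.
  by rewrite normrZ gtr0_norm ?invr_gt0// mulVf// gt_eqF.
by rewrite (dualZ _ _ df) normrM gtr0_norm ?invr_gt0// mulrC.
Qed.

Lemma duality_mapping_diag p f x : 1 < p -> duality_mapping p x f ->
  f x = `|x| `^ p.
Proof. by move=> p1 [_ -> ->]; rewrite mulr_powRB1//; lra. Qed.

(** So [p f] is a subgradient of |.|^p at [z]: f z = |z|^p and f w <= |z|^(p-1) |w|, and Young's
    inequality bounds the last product. *)
Lemma duality_mapping_subgradient p f z w : 1 < p -> duality_mapping p z f ->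
  `|z| `^ p + p * f (w - z) <= `|w| `^ p.
Proof.
move=> p1 jf; have [df _ nf] := jf.
rewrite (dualB _ _ df) (duality_mapping_diag p1 jf).
have := ler_dual_norm w df; rewrite nf => /(le_trans (ler_norm _)) fw.
have := powR_young p1 (normr_ge0 w) (normr_ge0 z).
have : p * f w <= p * (`|w| * `|z| `^ (p - 1)) by rewrite ler_pM2l 1?mulrC; lra.
lra.
Qed.

End dual_space.

(** * Power-type bounds on the modulus of smoothness *)

Section modulus.
Context {R : realType} {X : normedModType R}.
Implicit Types (x y : X) (p s e K C : R).
Local Notation rho := (smoothness_modulus X).

Lemma ler_second_difference x y : `|x + y| + `|x - y| <= 2 * `|x| + 2 * `|y|.
Proof.
have := ler_normD x y; have := ler_normB x y; lra.
Qed.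

Lemma ler_second_difference_ge x y : 2 * `|x| <= `|x + y| + `|x - y|.
Proof.
have := ler_normD (x + y) (x - y).
by rewrite addrACA subrr addr0 -mulr2n normrMn [_ * `|x|]mulr_natl.
Qed.

Lemma modulus_ge x y e : `|x| = 1 -> `|y| <= e ->
  `|x + y| + `|x - y| - 2 <= 2 * rho e.
Proof.
move=> x1 ye; rewrite mulrA divff// mul1r; apply: ub_le_sup; last by exists x, y.
exists (2 * e) => _ [u [v [u1 ve ->]]].
have := ler_second_difference u v; rewrite u1.
lra.
Qed.

Lemma modulus_le e K : 0 <= K ->
  (forall x y, `|x| = 1 -> `|y| <= e -> `|x + y| + `|x - y| - 2 <= 2 * K) ->
  rho e <= K.
Proof.
move=> K0 H; rewrite /smoothness_modulus mulrC ler_pdivrMr// mulrC.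
(* An empty set, as for X = {0}, has [sup] 0; here [0 <= K] enters. *)
set S := [set _ | _]; have [->|/set0P S0] := eqVneq S set0.
  by rewrite sup0 mulr_ge0.
by apply: ge_sup => // _ [x [y [x1 ye ->]]]; exact: H.
Qed.

Lemma modulus_le_id e : 0 <= e -> rho e <= e.
Proof.
move=> e0; apply: modulus_le => // x y x1 ye.
have := ler_second_difference x y; rewrite x1.
lra.
Qed.

Lemma modulus_ge0 e : 0 <= e -> 0 <= rho e.
Proof.
move=> e0; have [[x x1]|nx] := pselect (exists x : X, `|x| = 1).
  have := @modulus_ge x 0 e x1; rewrite normr0 => /(_ e0).
  by rewrite addr0 subr0 x1; lra.
rewrite /smoothness_modulus (_ : [set _ | _] = set0) ?sup0 ?mulr0//.
by apply/seteqP; split=> // r [x [y [x1 _ _]]]; apply: nx; exists x.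
Qed.

(** All [e >= 0] are included, not just small ones: the ratios fed to the modulus in the Xu-Roach
    inequalities range up to 2. *)
Definition power_type_modulus s : Prop :=
  exists2 C, 0 < C & forall e, 0 <= e -> rho e <= C * e `^ s.

Lemma power_type_modulus_suff p s C : 1 < p -> 1 < s -> 0 < C ->
  (forall x y, `|x| = 1 -> `|y| <= 1 ->
    `|x + y| `^ p + `|x - y| `^ p <= 2 + C * `|y| `^ s) ->
  power_type_modulus s.
Proof.
move=> p1 s1 C0 H; have p0 : 0 < p by lra.
(* The summand [C] serves [e <= 1] and the summand 1 serves [e > 1]. *)
exists (1 + C); first lra.
move=> e e0; have [e1|e1] := leP e 1.
  apply: modulus_le => [|x y x1 ye].
    by rewrite mulr_ge0 ?powR_ge0//; lra.
  have := H x y x1 (le_trans ye e1).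
  have := powR_bernoulli p1 (normr_ge0 (x + y)).
  have := powR_bernoulli p1 (normr_ge0 (x - y)).
  have : `|y| `^ s <= e `^ s by rewrite ge0_ler_powR ?nnegrE//; lra.
  rewrite -(ler_pM2l C0).
  have := ler_second_difference_ge x y; rewrite x1 mulr1.
  have := powR_ge0 e s.
  have := mulr_ge0 (ltW C0) (powR_ge0 e s).
  set a := `|x + y|; set b := `|x - y|; set c := a `^ p; set d := b `^ p.
  set E := e `^ s; set Y := _ `^ s.
  move=> CE0 E0 ab YE Hb Ha Hs.
  (* Nonnegativity allows dropping the factor [p > 1] that Bernoulli's inequality produces. *)
  have ab' : 0 <= a + b - 2 by lra.
  have : (a + b - 2) <= p * (a + b - 2) by rewrite ler_peMl// ltW.
  lra.
apply: le_trans (modulus_le_id e0) _.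
have := le1r_powR (ltW e1) (ltW s1); have := mulr_ge0 (ltW C0) (powR_ge0 e s).
lra.
Qed.

(** The linear terms at [y] and [- y] cancel, which leaves the constant [2 * C]. This serves both
    [s]-smoothness, with [p = s], and the bound on [sigma_tilde]. *)
Lemma power_type_modulus_onesided p s C (f : X -> X -> R) :
  1 < p -> 1 < s -> 0 < C -> (forall x, dual (f x)) ->
  (forall x y, `|x| = 1 -> `|y| <= 1 ->
    `|x - y| `^ p <= 1 - p * f x y + C * `|y| `^ s) ->
  power_type_modulus s.
Proof.
move=> p1 s1 C0 df H; apply: (@power_type_modulus_suff p s (2 * C)) => //.
  lra.
move=> x y x1 y1; have := H x y x1 y1; have := H x (- y) x1.
rewrite opprK normrN (dualN _ (df x)) => /(_ y1); lra.
Qed.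

Lemma power_type_modulus_holder p s C (f : X -> X -> R) :
  1 < p -> 1 < s -> 0 < C -> (forall x, duality_mapping p x (f x)) ->
  (forall x y, dual_norm (f x \- f y) <=
    C * Num.max `|x| `|y| `^ (p - s) * `|x - y| `^ (s - 1)) ->
  power_type_modulus s.
Proof.
move=> p1 s1 C0 jf H; have p0 : 0 < p by lra.
(* The maximum of |x + y| and |x - y| lies in [1, 2], so its power [p - s] is at most 2^|p-s| for
   either sign of [p - s]; 2^(s-1) comes from the distance |2 y|. *)
pose K := p * (C * 2 `^ `|p - s| * 2 `^ (s - 1)).
have K0 : 0 < K by rewrite !mulr_gt0// powR_gt0.
apply: (@power_type_modulus_suff p s K) => // x y x1 y1.
have d z : dual (f z) by have [] := jf z.
(* Both subgradient inequalities are tested at the midpoint [x], so only [f (x + y) - f (x - y)],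
   applied to [y], remains. *)
have := duality_mapping_subgradient x p1 (jf (x + y)).
have := duality_mapping_subgradient x p1 (jf (x - y)).
rewrite opprB [x + (y - x)]addrC subrK opprD addrA subrr sub0r (dualN _ (d _)).
rewrite x1 powR1 => Hm Hp.
suff : p * (f (x + y) y - f (x - y) y) <= K * `|y| `^ s by lra.
rewrite /K -mulrA ler_pM2l//.
have := ler_dual_norm y (dual_sub (d (x + y)) (d (x - y))) => /=.
move=> /(le_trans (ler_norm _))/le_trans; apply.
have -> : `|y| `^ s = `|y| `^ (s - 1) * `|y| by rewrite mulrC mulr_powRB1//; lra.
rewrite [leRHS]mulrA ler_wpM2r//.
apply: le_trans (H _ _) _.
have -> : x + y - (x - y) = 2 *: y.
  by rewrite opprB addrCA [x + y]addrC addrK scaler_nat mulr2n.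
rewrite normrZ ger0_norm// powRM// mulrA ler_wpM2r ?powR_ge0//.
rewrite ler_wpM2r ?powR_ge0// ler_wpM2l ?(ltW C0)//.
set M := Num.max _ _.
have M1 : 1 <= M.
  rewrite /M le_max; have := ler_second_difference_ge x y; rewrite x1 => h.
  by case: (leP 1 `|x + y|) => //= ?; lra.
have M2 : M <= 2.
  rewrite /M ge_max; have := ler_normD x y; have := ler_normB x y; rewrite x1.
  by move=> ? ?; apply/andP; split; lra.
apply: (@le_trans _ _ (M `^ `|p - s|)).
  by rewrite ler_powR// ler_norm.
by rewrite ge0_ler_powR ?nnegrE//; lra.
Qed.

(* If f1, f2 are in J_p(x), then adding f1 (x + t y) <= |f1| |x + t y| and
   f2 (x - t y) <= |f2| |x - t y| gives t (f1 - f2) y = O(rho_X(t |y| / |x|)),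
   which is o(t). *)
Lemma single_valued_duality_mapping p s : 1 < p -> 1 < s ->
  power_type_modulus s -> (forall x, exists f, duality_mapping p x f) ->
  single_valued (@duality_mapping R X p).
Proof.
move=> p1 s1 [C C0 HC] ex x; have [f jf] := ex x; exists f; split => // g jg.
suff H f1 f2 y :
    duality_mapping p x f1 -> duality_mapping p x f2 -> f1 y <= f2 y.
  by apply/funext => y; apply/eqP; rewrite eq_le !H.
move=> {f g jf jg} [d1 e1 n1] [d2 e2 n2].
(* At [x = 0] both functionals have norm 0^(p-1) = 0. *)
have [x0|x0] := eqVneq x 0.
  have := ler_dual_norm y d1; have := ler_dual_norm y d2.
  rewrite n1 n2 x0 normr0 powR0 ?mul0r ?normr_le0; last by lra.
  by move=> /eqP-> /eqP->.
have nx0 : 0 < `|x| by rewrite normr_gt0.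
have key t : 0 < t -> t * (f1 y - f2 y) <=
    `|x| `^ (p - 1) * (2 * `|x| * (C * (t * `|y| / `|x|) `^ s)).
  move=> t0.
  have h1 := le_trans (ler_norm _) (ler_dual_norm (x + t *: y) d1).
  have h2 := le_trans (ler_norm _) (ler_dual_norm (x - t *: y) d2).
  move: h1 h2; rewrite n1 n2 (dualD _ _ d1) (dualB _ _ d2).
  rewrite (dualZ _ _ d1) (dualZ _ _ d2) e1 e2 n1 n2 => h1 h2.
  (* The modulus sees only unit vectors, so everything is scaled by 1/|x|. *)
  pose u := `|x|^-1 *: x; pose v := (t / `|x|) *: y.
  have u1 : `|u| = 1 by rewrite normrZ gtr0_norm ?invr_gt0// mulVf// gt_eqF.
  have nv : `|v| = t * `|y| / `|x|.
    by rewrite normrZ gtr0_norm ?divr_gt0// mulrAC.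
  have := @modulus_ge u v _ u1 (lexx _).
  have := HC _ (normr_ge0 v).
  rewrite nv => hC hm.
  have xE : x = `|x| *: u by rewrite scalerA divff ?gt_eqF// scale1r.
  have yE : t *: y = `|x| *: v by rewrite scalerA mulrCA divff ?gt_eqF// mulr1.
  have h : `|x + t *: y| + `|x - t *: y| - 2 * `|x| =
      `|x| * (`|u + v| + `|u - v| - 2).
    rewrite {1 2}xE yE -scalerDr -scalerBr !normrZ normr_id; ring.
  have : t * (f1 y - f2 y) <=
      `|x| `^ (p - 1) * (`|x + t *: y| + `|x - t *: y| - 2 * `|x|) by lra.
  move=> /le_trans; apply; rewrite h ler_wpM2l ?powR_ge0// -mulrA [leRHS]mulrCA.
  rewrite ler_pM2l//; lra.
have [//|lt21] := leP (f1 y) (f2 y).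
pose K := `|x| `^ (p - 1) * (2 * `|x| * (C * (`|y| / `|x|) `^ s)).
have K0 : 0 <= K by rewrite !mulr_ge0 ?powR_ge0// ltW.
have key2 t : 0 < t -> f1 y - f2 y <= K * t `^ (s - 1).
  move=> t0; rewrite -(ler_pM2l t0); apply: le_trans (key _ t0) _.
  rewrite -[_ / `|x|]mulrA (powRM _ (ltW t0)) ?divr_ge0//.
  have -> : t `^ s = t * t `^ (s - 1) by rewrite mulr_powRB1//; lra.
  by rewrite /K le_eqVlt; apply/orP; left; apply/eqP; ring.
(* With D = f1 y - f2 y > 0 and t^(s-1) = a, [key2] gives D <= K D / (2 (K + 1)) < D, a
   contradiction that replaces the limit t -> 0. *)
pose a := (f1 y - f2 y) / (2 * (K + 1)).
have a0 : 0 < a by rewrite divr_gt0 ?mulr_gt0//; lra.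
have := key2 (a `^ (s - 1)^-1) (powR_gt0 _ a0).
rewrite -powRrM mulVf ?powRr1 ?(ltW a0)//; last lra.
rewrite /a mulrA ler_pdivlMr ?mulr_gt0//; last lra.
set D := f1 y - f2 y; have D0 : 0 < D by rewrite /D; lra.
have := mulr_ge0 K0 (ltW D0).
lra.
Qed.

End modulus.

(** * The integrand of [sigma_tilde] and its power-type majorant *)

Section sigma_integrand.
Context {R : realType} {X : normedModType R}.
Implicit Types (x y : X) (p s h C : R).
Local Notation rho := (smoothness_modulus X).
Local Notation mu := (@lebesgue_measure R).

(** By convexity, the largest norm on the segment from [x] to [x - h *: y]. *)
Definition seg_max x y h : R := Num.max `|x - h *: y| `|x|.

Definition power_integrand p s x y h : R :=
  h `^ (s - 1) * seg_max x y h `^ (p - s) * `|y| `^ s.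

Lemma seg_max_ge x y h : `|x| <= seg_max x y h.
Proof. by rewrite le_max lexx orbT. Qed.

Lemma seg_max_ge0 x y h : 0 <= seg_max x y h.
Proof. exact: le_trans (seg_max_ge x y h). Qed.

Lemma seg_max_le x y h : 0 <= h <= 1 -> seg_max x y h <= `|x| + `|y|.
Proof.
move=> /andP[h0 h1]; rewrite ge_max lerDl normr_ge0 andbT.
by rewrite (le_trans (ler_normB _ _))// lerD2l normrZ ger0_norm// ler_piMl.
Qed.

Lemma power_integrand_ge0 p s x y h : 0 <= power_integrand p s x y h.
Proof. by rewrite !mulr_ge0 ?powR_ge0. Qed.

(** With M the maximum, M^p / h times (h |y| / M)^s is h^(s-1) M^(p-s) |y|^s. *)
Lemma sigma_integrand_le p s C x y h : 0 < p ->
  0 < C -> (forall e, 0 <= e -> rho e <= C * e `^ s) -> 0 <= h ->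
  0 <= seg_max x y h `^ p / h * rho (h * `|y| / seg_max x y h)
    <= C * power_integrand p s x y h.
Proof.
move=> p0 C0 HC h0; have M0 := seg_max_ge0 x y h.
have e0 : 0 <= h * `|y| / seg_max x y h by rewrite divr_ge0 ?mulr_ge0.
rewrite mulr_ge0 ?modulus_ge0// ?divr_ge0 ?powR_ge0//=.
have rhs0 : 0 <= C * power_integrand p s x y h.
  by rewrite mulr_ge0 ?power_integrand_ge0// ltW.
(* The power laws need nonzero bases. If [h] or the maximum is 0, the left side is 0 by
   convention. *)
have [hE|hn0] := eqVneq h 0; first by move: rhs0; rewrite hE invr0 mulr0 mul0r.
have [ME|Mn0] := eqVneq (seg_max x y h) 0.
  by move: rhs0; rewrite ME powR0 ?gt_eqF// !mul0r.
have Mp : 0 < seg_max x y h by rewrite lt0r Mn0.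
have hp : 0 < h by rewrite lt0r hn0.
apply: le_trans (ler_wpM2l _ (HC _ e0)) _; first by rewrite divr_ge0 ?powR_ge0.
rewrite /power_integrand powRM ?invr_ge0 ?mulr_ge0// (powRM _ h0)//.
rewrite -(powR_inv1 M0) -powRrM !powRB ?Mn0 ?hn0 ?implybT// mulN1r powRN powRr1//.
by rewrite le_eqVlt; apply/orP; left; apply/eqP; ring.
Qed.

(** Provides the finiteness that the real-valued integral requires. For [x = 0] and nonzero [h],
    [y], the powers combine to h^(p-1) |y|^p. *)
Lemma power_integrand_bounded p s x y : 1 < p -> 1 < s ->
  exists K, forall h, 0 <= h <= 1 -> power_integrand p s x y h <= K.
Proof.
move=> p1 s1.
have [->|x0] := eqVneq x 0.
  exists (`|y| `^ p) => h /andP[h0 h1]; rewrite /power_integrand /seg_max.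
  rewrite sub0r normrN normr0 normrZ (ger0_norm h0) max_l ?mulr_ge0//.
  have [->|hn0] := eqVneq h 0.
    by rewrite powR0 ?mul0r ?powR_ge0// gt_eqF//; lra.
  have [->|yn0] := eqVneq `|y| 0.
    by rewrite (@powR0 _ s) ?mulr0 ?powR_ge0// gt_eqF//; lra.
  rewrite powRM// mulrA -powRD ?hn0 ?implybT// -mulrA -powRD ?yn0 ?implybT//.
  rewrite subrK ler_piMl ?powR_ge0//.
  have -> : s - 1 + (p - s) = p - 1 by ring.
  by rewrite powR_le1 ?h0// subr_ge0 ltW.
have nx0 : 0 < `|x| by rewrite normr_gt0.
(* The maximum lies between |x| and |x| + |y|; one summand covers [s <= p], the other [p <= s]. *)
exists (((`|x| + `|y|) `^ (p - s) + `|x| `^ (p - s)) * `|y| `^ s) => h h01.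
rewrite ler_wpM2r ?powR_ge0//.
apply: (@le_trans _ _ (seg_max x y h `^ (p - s))).
  by rewrite ler_piMl ?powR_ge0// powR_le1// subr_ge0 ltW.
have xM := seg_max_ge x y h.
have [ps|/ltW ps] := leP s p.
  rewrite ler_wpDr ?powR_ge0//.
  by apply: ge0_ler_powR;
    rewrite ?nnegrE ?subr_ge0 ?seg_max_ge0 ?seg_max_le ?addr_ge0.
rewrite ler_wpDl ?powR_ge0// -opprB !powRN lef_pV2 ?posrE ?powR_gt0//.
  by rewrite ge0_ler_powR ?nnegrE ?seg_max_ge0 ?subr_ge0.
exact: lt_le_trans xM.
Qed.

Lemma power_integrand_unit p s x y h : 1 < s -> `|x| = 1 -> `|y| <= 1 ->
  0 <= h <= 1 -> power_integrand p s x y h <= 2 `^ `|p - s| * `|y| `^ s.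
Proof.
move=> s1 x1 y1 h01; rewrite ler_wpM2r ?powR_ge0//.
apply: (@le_trans _ _ (seg_max x y h `^ (p - s))).
  by rewrite ler_piMl ?powR_ge0// powR_le1// subr_ge0 ltW.
have xM := seg_max_ge x y h; have Mxy := seg_max_le x y h01.
rewrite x1 in xM Mxy.
apply: (@le_trans _ _ (seg_max x y h `^ `|p - s|)).
  by rewrite ler_powR// ler_norm.
by rewrite ge0_ler_powR ?nnegrE//; lra.
Qed.

Lemma power_integrand_diag s x y h : 1 < s -> 0 <= h <= 1 ->
  power_integrand s s x y h <= `|y| `^ s.
Proof.
move=> s1 h01; rewrite /power_integrand subrr powRr0 mulr1 ler_piMl ?powR_ge0//.
by rewrite powR_le1// subr_ge0 ltW.
Qed.

(** Needed to pull a constant out of the integral. *)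
Lemma measurable_power_integrand p s x y :
  measurable_fun (`[0%R, 1%R] : set R) (power_integrand p s x y).
Proof.
apply: measurable_funS measurableT _ _ => //.
apply: measurable_funM; last exact: measurable_cst.
apply: measurable_funM; first exact: measurable_powR.
apply: (measurableT_comp (measurable_powR _)).
apply: measurable_maxr; last exact: measurable_cst.
apply: continuous_measurable_fun => h.
apply: cvg_norm; apply: cvgB; first exact: cvg_cst.
by apply: cvgZr_tmp.
Qed.

Lemma Rintegral_power_integrandZ C p s x y : 1 < p -> 1 < s -> 0 <= C ->
  \int[mu]_(h in `[0%R, 1%R]) (C * power_integrand p s x y h) =
  C * \int[mu]_(h in `[0%R, 1%R]) power_integrand p s x y h.
Proof.
move=> p1 s1 C0; have [K HK] := power_integrand_bounded x y p1 s1.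
rewrite /Rintegral -[X in _ = X * _]/(fine C%:E) -fineM//; last first.
  by apply: (@fin_num_integral01 _ _ K) => h h01; rewrite power_integrand_ge0 HK.
rewrite -ge0_integralZl_EFin//.
  by move=> h _; rewrite lee_fin power_integrand_ge0.
by apply/measurable_EFinP; exact: measurable_power_integrand.
Qed.

Lemma sigma_tilde_le p s G C x y : 1 < p -> 1 < s -> 0 <= G -> 0 < C ->
  (forall e, 0 <= e -> rho e <= C * e `^ s) ->
  sigma_tilde G p x y <= G * C * p *
    \int[mu]_(h in `[0%R, 1%R]) power_integrand p s x y h.
Proof.
move=> p1 s1 G0 C0 HC; have [K HK] := power_integrand_bounded x y p1 s1.
rewrite (_ : G * C * p = p * G * C); last by ring.
rewrite -[leRHS]mulrA -Rintegral_power_integrandZ ?(ltW C0)//.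
rewrite ler_wpM2l ?mulr_ge0//; first lra.
apply: (@le_Rintegral01 _ _ _ (C * K)) => h h01.
  by apply: sigma_integrand_le => //; [lra|case/andP: h01].
by rewrite ler_pM2l// HK.
Qed.

End sigma_integrand.

Theorem lemma2p18 (R : realType) (X : completeNormedModType R)
    (smoothX : uniformly_smooth X)
    (j : R -> X -> X -> R)
    (jP : forall q : R, 1 < q -> selection (duality_mapping q) (j q))
    (G' : R -> R)
    (G'P : forall p : R, 1 < p -> xu_roach_constant j (G' p) p)
    (s : R) (s_gt1 : 1 < s) :
  [<-> power_smooth j s;
       exists2 p : R, 1 < p & duality_mapping_holder j s p;
       forall p : R, 1 < p -> duality_mapping_holder j s p;
       exists2 p : R, 1 < p & sigma_tilde_bound j (G' p) s p;
       forall p : R, 1 < p -> sigma_tilde_bound j (G' p) s p].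
Proof.
have dualj p x : 1 < p -> dual (j p x) by move=> p1; have [] := jP p p1 x.
have holder p : power_type_modulus (X := X) s -> 1 < p ->
    duality_mapping_holder j s p.
  move=> Xs p1; split.
    by apply: single_valued_duality_mapping Xs _ => // x; exists (j p x); exact: jP.
  have [C C0 HC] := Xs; have [G0 HG _] := G'P p p1.
  exists (G' p * C) => [|x y]; first exact: mulr_gt0.
  apply: le_trans (HG x y) _; set M := Num.max _ _.
  have M0 : 0 <= M by rewrite le_max normr_ge0.
  have d0 : 0 <= `|x - y| / M by rewrite divr_ge0.
  apply: le_trans (ler_wpM2l _ (HC _ d0)) _.
    by rewrite !mulr_ge0 ?powR_ge0 ?invr_ge0// ltW.
  (* For [x = y] the bound is 0 since the inverse of 0 is 0; otherwise both bases are nonzero and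
     the powers can be collected. *)
  have [xy|xy] := eqVneq `|x - y| 0.
    by rewrite xy invr0 mulr0 mul0r !mulr_ge0 ?powR_ge0// ltW.
  have Mn0 : M != 0.
    apply: contra_neq xy => ME; apply/eqP; rewrite eq_le normr_ge0 andbT.
    apply: le_trans (ler_normB _ _) _.
    have : `|x| <= M by rewrite le_max lexx.
    have : `|y| <= M by rewrite le_max lexx orbT.
    by rewrite ME; lra.
  rewrite powRM ?invr_ge0// -(powR_inv1 M0) -powRrM.
  rewrite !powRB ?xy ?Mn0 ?implybT// mulN1r powRN powRr1//.
  by rewrite le_eqVlt; apply/orP; left; apply/eqP; ring.
have sigma p : power_type_modulus (X := X) s -> 1 < p ->
    sigma_tilde_bound j (G' p) s p.
  move=> [C C0 HC] p1; have [G0 _ HG] := G'P p p1; split => //.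
  exists (G' p * C) => [|x y]; first exact: mulr_gt0.
  by apply: sigma_tilde_le => //; exact: ltW.
have of_holder p : 1 < p -> duality_mapping_holder j s p ->
    power_type_modulus (X := X) s.
  move=> p1 [_ [C C0 HC]].
  by apply: (power_type_modulus_holder p1 s_gt1 C0 _ HC) => x; exact: jP.
tfae.
- move=> [G G0 HG]; exists s => //; apply: holder => //.
  apply: (@power_type_modulus_onesided _ _ s s G (j s)) => //.
    by move=> x; exact: dualj.
  by move=> x y x1 y1; have := HG x y; rewrite x1 powR1.
- move=> [p p1 H] q q1; apply: holder => //; exact: of_holder H.
- move=> H; exists s => //; apply: sigma => //; exact: of_holder (H s s_gt1).
- move=> [p p1 [sm [C C0 HC]]] q q1; apply: sigma => //.
  (* For |x| = 1 and |y| <= 1 the maximum lies in [1, 2], so the integrand is at most 2^|p-s| |y|^s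
     on an interval of length 1. *)
  apply: (@power_type_modulus_onesided _ _ p s (C * p * 2 `^ `|p - s|) (j p)) => //.
  + by rewrite !mulr_gt0 ?powR_gt0//; lra.
  + by move=> x; exact: dualj.
  move=> x y x1 y1; apply: le_trans (sm x y) _; rewrite x1 powR1 lerD2l.
  apply: le_trans (HC x y) _; rewrite -[leRHS]mulrA ler_pM2l; last first.
    by rewrite mulr_gt0//; lra.
  apply: Rintegral01_le_bound => h h01.
  by rewrite power_integrand_ge0 power_integrand_unit.
(* At [p = s] the maximum has exponent 0 and h^(s-1) <= 1, so the integral is at most |y|^s. *)
- move=> H; have [sm [C C0 HC]] := H s s_gt1.
  exists (C * s) => [|x y]; first by rewrite mulr_gt0//; lra.
  apply: le_trans (sm x y) _; rewrite lerD2l; apply: le_trans (HC x y) _.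
  rewrite ler_pM2l; last by rewrite mulr_gt0//; lra.
  apply: Rintegral01_le_bound => h h01.
  by rewrite power_integrand_ge0 power_integrand_diag.
Qed.
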